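(* Let $G$ be a finite group, and for every subgroup $H \le G$ let $\psi(H)=\sum_{x\in H} o(x)$. Then the condition $$|H|-|K| \ \text{ divides } \ \psi(H)-\psi(K) \ \text{ in } \mathbb{Z}, \quad \text{for all subgroups } K\le H\le G,$$ holds if and only if there is a prime $p$ such that $G$ is a $p$-group of exponent $p$.
   Context: For a finite group $H$, $o(x)$ denotes the order of the element $x\in H$, and $\psi(H)=\sum_{x\in H}o(x)$ is the sum of the orders of all elements of $H$. Divisibility $a\mid b$ of integers means $b=ac$ for some integer $c$; in particular $0\mid 0$, so the case $K=H$ of the condition holds trivially. For a prime $p$, ''$p$-group of exponent $p$'' means a finite group whose order is a power of $p$ and in which every non-identity element has order $p$ (equivalently, $x^p=1$ for all $x$); the trivial group is included. *)

(* Defs.v *)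
From mathcomp Require Import all_boot all_algebra all_fingroup all_solvable.

Set Implicit Arguments.
Unset Strict Implicit.
Unset Printing Implicit Defensive.

Import GroupScope.

Definition psi (gT : finGroupType) (A : {set gT}) : nat :=
  (\sum_(x in A) #[x])%N.

(* The trivial group qualifies for every prime p, so this is not the same as
   requiring [exponent G = p]. *)
Definition pgroup_of_exponent (p : nat) (gT : finGroupType) (G : {group gT})
    : Prop :=
  p.-group G /\ (forall x : gT, x \in G -> x != 1 -> #[x] = p).

(* Main.v *)
Require Import Defs.
From mathcomp Require Import all_boot all_algebra all_fingroup all_solvable.
From mathcomp Require Import zify.

Set Implicit Arguments.
Unset Strict Implicit.
Unset Printing Implicit Defensive.

Import GroupScope.

(** For [K] inside [H] the condition says that the average order of the
elements of [H] outside [K] is an integer.  If all nontrivial elements have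
order [p], this average is [p] whenever it makes sense.

Conversely, two families of cyclic groups violate the condition: order [p ^ 2]
(compare with the trivial subgroup) and order [p * q] with primes [p < q]
(compare with the subgroup of order [q]).  Hence every nontrivial element of
[G] has prime order ([prime_order]).

Let now [n] be the order of [G], let [p] and [r] be the least and the greatest
prime divisors of [n], and let [k] be the average order of the nontrivial
elements, so that [p <= k <= r].  Removing a subgroup of order [p] from [G]
leaves [n - p] elements whose orders add up to
[k * (n - 1) - p * (p - 1) = k * (n - p) + (k - p) * (p - 1)],
so [n - p] divides [(k - p) * (p - 1)].  If [p < k], then [p * r] divides [n],
and [(k - p) * (p - 1)] is positive but smaller than [p * r - p], which is
impossible.  So [k = p]: the average of the orders is their minimum, and every
nontrivial element has order [p]. *)

(** Working with [H :\: K] turns the subtraction of two order sums into the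
single sum [psi (H :\: K)], so the whole argument takes place in [nat]. *)
Definition integral_averages (gT : finGroupType) (G : {group gT}) : Prop :=
  forall H K : {group gT}, K \subset H -> H \subset G ->
    #|H :\: K| %| psi (H :\: K).

Lemma psi_setD (gT : finGroupType) (A B : {set gT}) :
  B \subset A -> psi A = (psi B + psi (A :\: B))%N.
Proof. by move=> sBA; rewrite /psi (big_setID B) /= (setIidPr sBA). Qed.

Lemma psi_const (gT : finGroupType) (A : {set gT}) (m : nat) :
  (forall x, x \in A -> #[x] = m) -> psi A = (#|A| * m)%N.
Proof. by move=> oA; rewrite /psi (eq_bigr _ oA) sum_nat_const. Qed.

Lemma cardsD_group (gT : finGroupType) (H K : {group gT}) :
  K \subset H -> #|H :\: K| = (#|H| - #|K|)%N.
Proof. by move=> sKH; rewrite cardsD (setIidPr sKH). Qed.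

Lemma integral_averagesP (gT : finGroupType) (G : {group gT}) :
  (forall H K : {group gT}, K \subset H -> H \subset G ->
     ((#|H|%:Z - #|K|%:Z)%R %| ((psi H)%:Z - (psi K)%:Z)%R)%Z)
  <-> integral_averages G.
Proof.
have E (H K : {group gT}) : K \subset H ->
  ((#|H|%:Z - #|K|%:Z)%R %| ((psi H)%:Z - (psi K)%:Z)%R)%Z
    = (#|H :\: K| %| psi (H :\: K)).
  move=> sKH; rewrite cardsD_group // (psi_setD sKH).
  rewrite (subzn (leq_addr _ _)) (subzn (subset_leq_card sKH)).
  by rewrite addKn dvdzE !absz_nat.
by split=> int H K sKH sHG; have := int H K sKH sHG; rewrite E.
Qed.

(** A cyclic group has one subgroup of each order, so the order of an element
alone decides which subgroups contain it.  This is how order sums over cyclic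
groups are evaluated below. *)
Lemma mem_cyclic_subgroup (gT : finGroupType) (H K : {group gT}) (y : gT) :
  cyclic H -> K \subset H -> y \in H -> #[y] %| #|K| -> y \in K.
Proof.
by move=> cycH sKH Hy; rewrite -cycle_subG -(cardSg_cyclic cycH) ?cycle_subG.
Qed.

Lemma setD1D_group (gT : finGroupType) (A : {set gT}) (L : {group gT}) :
  (A :\: [1 gT]) :\: (L :\: [1 gT]) = A :\: L.
Proof.
by apply/setP=> x; rewrite !inE; case: eqP => [->|]; rewrite ?group1 ?andbF.
Qed.

Lemma psi_prime_setD1 (gT : finGroupType) (L : {group gT}) (p : nat) :
  prime p -> #|L| = p -> psi (L :\: [1 gT]) = (p.-1 * p)%N.
Proof.
move=> p_pr oL; rewrite (psi_const (m := p)) => [|x /setDP[Lx nx1]].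
  by rewrite cardsD_group ?sub1G // oL cards1 subn1.
have := order_dvdG Lx; rewrite oL => /(prime_nt_dvdP p_pr) -> //.
by rewrite order_eq1; apply: contra nx1 => /eqP ->; rewrite inE.
Qed.

(** Cancelling [p - 1] reduces the divisibility to [p + 1 %| p * (1 + p ^ 2)];
since [p] is congruent to [-1] modulo [p + 1], this says [p + 1 %| 2]. *)
Lemma ndvdn_order_sum_prime_square (p : nat) :
  1 < p -> ~~ (p * p - 1 %| p.-1 * p + (p * p - p) * (p * p)).
Proof.
move=> p1; apply/negP=> /dvdnP[k]; case: p p1 => // p p1 E.
have {}E : (p.+1 * (1 + p.+1 * p.+1) = k * p.+2)%N.
  apply/eqP; rewrite -(eqn_pmul2l (m := p)) //; apply/eqP; nia.
suff /dvdn_leq : p.+2 %| 2 by lia.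
rewrite -(dvdn_addr (m := p.+1 * (1 + p.+1 * p.+1))%N) ?E ?dvdn_mull //.
by apply/dvdnP; exists (p.+1 * p.+1 - p.+1 + 2)%N; nia.
Qed.

(** In a cyclic group of order [p ^ 2] there are [p - 1] elements of order [p]
and [p ^ 2 - p] of order [p ^ 2], so the condition for the trivial subgroup
is the divisibility excluded above. *)
Lemma order_neq_prime_square (gT : finGroupType) (G : {group gT}) (x : gT)
    (p : nat) :
  integral_averages G -> x \in G -> prime p -> #[x] <> (p * p)%N.
Proof.
move=> int Gx p_pr ox; have p1 := prime_gt1 p_pr.
have sHG : <[x]> \subset G by rewrite cycle_subG.
have oK : #|<[x ^+ p]>| = p.
  by rewrite [LHS]orderXdiv ox ?dvdn_mull // mulKn // prime_gt0.
have sKH : <[x ^+ p]> \subset <[x]> by rewrite cycleX.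
have := int <[x]>%G 1%G (sub1G _) sHG.
rewrite (psi_setD (B := <[x ^+ p]> :\: [1 gT])) ?setSD //.
rewrite (psi_prime_setD1 p_pr) // setD1D_group.
rewrite (psi_const (m := p * p)%N) => [|y /setDP[Hy nKy]].
  rewrite !cardsD_group ?sub1G // oK cards1 [#|_|]ox.
  by apply/negP; apply: ndvdn_order_sum_prime_square.
have := order_dvdG Hy; rewrite [#|_|]ox mulnn.
case/(dvdn_pfactor _ _ p_pr)=> [[|[|[|m]]]] // _ oy.
all: by case/negP: nKy; apply: mem_cyclic_subgroup (cycle_cyclic x) sKH Hy _;
  rewrite oy oK ?dvd1n.
Qed.

(** Let [H] be cyclic of order [p * q] and [K] its subgroup of order [q].  The
number [p * q - q] of elements outside [K] is a multiple of [q].  Of these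
elements, [p - 1] have order [p] and the others have order [p * q], so the
order sum is congruent to [(p - 1) * p] modulo [q], which is not [0] when
[p < q]. *)
Lemma order_neq_prime_mul (gT : finGroupType) (G : {group gT}) (x : gT)
    (p q : nat) :
  integral_averages G -> x \in G -> prime p -> prime q -> p < q ->
  #[x] <> (p * q)%N.
Proof.
move=> int Gx p_pr q_pr ltpq ox.
have [p1 q1] := (prime_gt1 p_pr, prime_gt1 q_pr).
have cycH := cycle_cyclic x.
have sHG : <[x]> \subset G by rewrite cycle_subG.
have oK : #|<[x ^+ p]>| = q.
  by rewrite [LHS]orderXdiv ox ?dvdn_mulr // mulKn // prime_gt0.
have oL : #|<[x ^+ q]>| = p.
  by rewrite [LHS]orderXdiv ox ?dvdn_mull // mulnK // prime_gt0.
have sKH : <[x ^+ p]> \subset <[x]> by rewrite cycleX.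
have sLH : <[x ^+ q]> \subset <[x]> by rewrite cycleX.
have copq : coprime p q by rewrite prime_coprime // dvdn_prime2 // neq_ltn ltpq.
have tiLK : <[x ^+ q]> :&: <[x ^+ p]> = 1.
  by apply: coprime_TIg; rewrite oK oL.
have := int <[x]>%G <[x ^+ p]>%G sKH sHG.
rewrite (psi_setD (B := <[x ^+ q]> :\: [1 gT])); last first.
  by rewrite -tiLK setDIr setDv set0U setSD.
rewrite (psi_prime_setD1 p_pr) //.
rewrite (psi_const (A := _ :\: (_ :\: _)) (m := p * q)%N) => [|y]; last first.
  rewrite !inE negb_and negbK => /and3P[nLy nKy Hy].
  have oy : #[y] %| p * q by rewrite -ox order_dvdG.
  have {}nLy : y \notin <[x ^+ q]>.
    by case/orP: nLy => // /eqP y1; rewrite y1 group1 in nKy.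
  apply/eqP; rewrite eqn_dvd oy Gauss_dvd //=; apply/andP; split.
    apply: contraR nKy; rewrite -(prime_coprime _ p_pr) => cop.
    apply: mem_cyclic_subgroup cycH sKH Hy _.
    by rewrite oK -(Gauss_dvdr _ (n := p)) // coprime_sym.
  apply: contraR nLy; rewrite -(prime_coprime _ q_pr) => cop.
  apply: mem_cyclic_subgroup cycH sLH Hy _.
  by rewrite oL -(Gauss_dvdl _ (p := q)) // coprime_sym.
rewrite cardsD_group // oK [#|<[x]>|]ox; set N := #|_ :\: _| => dvd.
have q_dvd : q %| N * (p * q) by rewrite mulnA dvdn_mull.
have : q %| p.-1 * p.
  rewrite -(dvdn_addl _ q_dvd); apply: dvdn_trans dvd.
  by rewrite dvdn_sub ?dvdn_mull.
by rewrite Euclid_dvdM // => /orP[] /dvdn_leq; lia.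
Qed.

(** An element whose order is not prime has a power whose order is a product of
two primes, equal or distinct. *)
Lemma prime_order (gT : finGroupType) (G : {group gT}) (x : gT) :
  integral_averages G -> x \in G -> x != 1 -> prime #[x].
Proof.
move=> int Gx nx1; have o1 : 1 < #[x] by rewrite order_gt1.
have p_pr := pdiv_prime o1; set p := pdiv _ in p_pr.
have def_o : #[x] = (#[x] %/ p * p)%N by rewrite divnK // pdiv_dvd.
have o0 := order_gt0 x.
have [m1|m1] := leqP (#[x] %/ p) 1.
  suff -> : #[x] = p by [].
  by case: (_ %/ p) m1 def_o o0 => [|[|]] // _ ->; rewrite ?mul1n ?mul0n.
have q_pr := pdiv_prime m1; set q := pdiv (_ %/ p) in q_pr.
have q_dvd : q %| #[x] %/ p by apply: pdiv_dvd.
have pq_dvd : p * q %| #[x] by rewrite def_o mulnC dvdn_pmul2r ?prime_gt0.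
have le_pq : p <= q.
  by apply: pdiv_min_dvd; rewrite ?prime_gt1 // (dvdn_trans _ pq_dvd) ?dvdn_mull.
pose y := x ^+ (#[x] %/ (p * q)).
have oy : #[y] = (p * q)%N.
  by rewrite orderXdiv ?dvdn_div // divnA // mulKn.
have Gy : y \in G by rewrite groupX.
move: le_pq; rewrite leq_eqVlt => /predU1P[eq_pq|lt_pq].
  by case: (order_neq_prime_square int Gy p_pr); rewrite oy -eq_pq.
by case: (order_neq_prime_mul int Gy p_pr q_pr lt_pq oy).
Qed.

(** The arithmetic core: [k] is the average order of the nontrivial elements of
a group of order [n], and [S] is the order sum outside a subgroup of prime
order [p].  Modulo [n - p], [S] is [(k - p) * (p - 1)]; this is positive, and
at most [(r - p) * (p - 1)], which is less than [p * r - p <= n - p]. *)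
Lemma ndvdn_order_sum_outside_prime (n p r k S : nat) :
  1 < p -> p < k -> k <= r -> p * r <= n ->
  (p.-1 * p + S = k * (n - 1))%N -> ~~ (n - p %| S).
Proof.
move=> p1 lt_pk le_kr le_prn E.
have lt_pn : p < n by apply: leq_trans le_prn; rewrite ltn_Pmulr; lia.
have def_S : S = (k * (n - p) + (k - p) * p.-1)%N.
  (* Parametrizing [k] and [n] removes the truncated subtractions. *)
  have [[d def_k] [m def_n]] : (exists d, k = p + d)%N /\ (exists m, n = p + m)%N.
    by split; [exists (k - p)%N | exists (n - p)%N]; lia.
  by move: E; rewrite {}def_k {}def_n !addKn; case: (p) p1 => //= p'; lia.
rewrite def_S (dvdn_addr _ (dvdn_mull _ (dvdnn _))).
have pos : 0 < (k - p) * p.-1 by rewrite muln_gt0 subn_gt0 lt_pk; lia.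
apply/negP => /(dvdn_leq pos); apply/negP; rewrite -ltnNge.
have le_dr : (k - p) * p.-1 <= (r - p) * p.-1 by rewrite leq_mul2r leq_sub2r ?orbT.
apply: leq_ltn_trans le_dr _; rewrite ltn_subRL; apply: leq_trans le_prn.
have [e def_r] : (exists e, r = p + e)%N by exists (r - p)%N; lia.
by rewrite def_r addKn; case: (p) p1 => //= p'; lia.
Qed.

(** The average order [k] of the nontrivial elements exceeds the least prime
divisor of [#|G|] only if the condition fails for a subgroup of that prime
order; and an average equal to a lower bound of the orders forces all of them
to be equal to it. *)
Lemma order_eq_pdiv (gT : finGroupType) (G : {group gT}) :
  integral_averages G -> forall x, x \in G -> x != 1 -> #[x] = pdiv #|G|.
Proof.
move=> int; have [->|ntG] := eqsVneq G 1.
  by move=> x; rewrite inE => /eqP-> /eqP.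
have n1 : 1 < #|G| by rewrite cardG_gt1.
set p := pdiv #|G|; set r := max_pdiv #|G|.
have [p_pr r_pr] : prime p /\ prime r by rewrite pdiv_prime ?max_pdiv_prime.
have [p_dvd r_dvd] : p %| #|G| /\ r %| #|G| by rewrite pdiv_dvd max_pdiv_dvd.
have p1 := prime_gt1 p_pr.
have order_bounds x : x \in G :\: [1 gT] -> p <= #[x] <= r.
  case/setDP=> Gx nx1; have {nx1} nx1 : x != 1 by rewrite -in_set1.
  have o_pr := prime_order int Gx nx1; have o_dvd := order_dvdG Gx.
  rewrite pdiv_min_dvd ?prime_gt1 //= max_pdiv_max //.
  by rewrite mem_primes o_pr o_dvd andbT /=.
have oG1 : #|G :\: [1 gT]| = (#|G| - 1)%N.
  by rewrite (@cardsD_group _ G 1%G) ?sub1G // cards1.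
have /dvdnP[k def_k] := int G 1%G (sub1G G) (subxx G).
rewrite /= oG1 in def_k.
have le_kr : k <= r.
  rewrite -(leq_pmul2r (m := #|G| - 1)) ?subn_gt0 // -def_k mulnC -oG1.
  by rewrite -sum_nat_const leq_sum // => x /order_bounds/andP[].
have [le_kp|lt_pk] := leqP k p; last first.
  have [x Gx ox] := Cauchy p_pr p_dvd.
  have sLG : <[x]> \subset G by rewrite cycle_subG.
  have := int G <[x]>%G sLG (subxx G).
  rewrite cardsD_group // [#|<[x]>|]ox /=.
  have := def_k; rewrite (psi_setD (B := <[x]> :\: [1 gT])) ?setSD //.
  rewrite (psi_prime_setD1 p_pr) // setD1D_group => E.
  have lt_pr : p < r := leq_trans lt_pk le_kr.
  have le_prn : p * r <= #|G|.
    apply: dvdn_leq; first exact: ltnW.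
    by rewrite Gauss_dvd ?p_dvd // prime_coprime // dvdn_prime2 // neq_ltn lt_pr.
  by rewrite (negPf (ndvdn_order_sum_outside_prime p1 lt_pk le_kr le_prn E)).
(* Now [k <= p]: equality holds termwise in the sum of [p <= #[x]]. *)
have [_ eq_all] := leqif_sum (fun x (Gx : x \in G :\: [1 gT]) =>
  leqif_eq (proj1 (andP (order_bounds x Gx)))).
move=> x Gx nx1; apply/esym/eqP.
have /forall_inP : [forall (y | y \in G :\: [1 gT]), p == #[y]].
  rewrite -eq_all eqn_leq leq_sum => [|y /order_bounds/andP[] //].
  by rewrite sum_nat_const oG1 -/(psi _) def_k mulnC leq_mul2l le_kp orbT.
by apply; rewrite inE Gx in_set1 nx1.
Qed.

Lemma pgroup_of_exponentW (gT : finGroupType) (G : {group gT}) (p : nat) :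
  prime p -> (forall x, x \in G -> x != 1 -> #[x] = p) ->
  pgroup_of_exponent p G.
Proof.
move=> p_pr oG; split=> //; apply/pgroupP => q q_pr /(Cauchy q_pr)[x Gx ox].
rewrite -ox oG ?inE // -order_eq1 ox.
by rewrite eqn_leq leqNgt prime_gt1.
Qed.

Theorem theorem1p1 (gT : finGroupType) (G : {group gT}) :
  (forall H K : {group gT}, K \subset H -> H \subset G ->
     ((#|H|%:Z - #|K|%:Z)%R %| ((psi H)%:Z - (psi K)%:Z)%R)%Z)
  <-> (exists p : nat, prime p /\ pgroup_of_exponent p G).
Proof.
rewrite integral_averagesP; split=> [int|[p [_ [_ oG]]] H K sKH sHG].
  have [G1|ntG] := eqsVneq G 1.
    exists 2; split=> //; apply: pgroup_of_exponentW => // x.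
    by rewrite G1 inE => /eqP-> /eqP.
  have p_pr : prime (pdiv #|G|) by rewrite pdiv_prime ?cardG_gt1.
  by exists (pdiv #|G|); split=> //; apply: pgroup_of_exponentW (order_eq_pdiv int).
rewrite (psi_const (m := p)) ?dvdn_mulr // => x /setDP[Hx nKx].
apply: oG (subsetP sHG x Hx) _.
by apply: contraNneq nKx => ->; apply: group1.
Qed.
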